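(* Let $\mathcal{R}$ be a $2$-torsionfree commutative domain (with identity), let $n\geq 1$, and let $\mathcal{M}_n(\mathcal{R})$ be the full $n\times n$ matrix algebra over $\mathcal{R}$. Let $\mathfrak{q}\colon\mathcal{M}_n(\mathcal{R})\times\mathcal{M}_n(\mathcal{R})\to\mathcal{M}_n(\mathcal{R})$ be an $\mathcal{R}$-bilinear mapping whose trace $\mathfrak{T}_{\mathfrak{q}}(x)=\mathfrak{q}(x,x)$ is commuting. Then $\mathfrak{T}_{\mathfrak{q}}$ is proper: there exist $z\in\mathcal{Z}(\mathcal{M}_n(\mathcal{R}))$, an $\mathcal{R}$-linear mapping $\mu\colon\mathcal{M}_n(\mathcal{R})\to\mathcal{Z}(\mathcal{M}_n(\mathcal{R}))$ and a trace $\nu$ of some $\mathcal{R}$-bilinear mapping $\mathcal{M}_n(\mathcal{R})\times\mathcal{M}_n(\mathcal{R})\to\mathcal{Z}(\mathcal{M}_n(\mathcal{R}))$ such that $\mathfrak{T}_{\mathfrak{q}}(x)=zx^2+\mu(x)x+\nu(x)$ for all $x\in\mathcal{M}_n(\mathcal{R})$.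
   Context: $\mathcal{Z}(\cdot)$ denotes the center and $[x,y]=xy-yx$. $2$-torsionfree means $2r=0$ implies $r=0$. The trace of a bilinear mapping $\mathfrak{q}$ is the map $x\mapsto\mathfrak{q}(x,x)$; a map $f$ of an algebra into itself is commuting if $[f(x),x]=0$ for all $x$. *)

(* Defs.v *)
From HB Require Import structures.
From mathcomp Require Import all_boot all_algebra.

Set Implicit Arguments.
Unset Strict Implicit.
Unset Printing Implicit Defensive.

Import GRing.Theory.
Local Open Scope ring_scope.

Definition two_torsionfree (V : zmodType) : Prop :=
  forall r : V, r *+ 2 = 0 -> r = 0.

Definition commutator (A : pzRingType) (x y : A) : A := x * y - y * x.

Definition is_central (A : pzRingType) (z : A) : Prop :=
  forall a : A, z * a = a * z.

Definition commuting_map (A : pzRingType) (f : A -> A) : Prop :=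
  forall x : A, commutator (f x) x = 0.

Definition bitrace (A : Type) (q : A -> A -> A) : A -> A := fun x => q x x.

(* (Bi)linear maps into the center are (bi)linear maps into A all of whose
   values are central. *)
Definition proper_trace (R : comNzRingType) (A : algType R) (T : A -> A)
    : Prop :=
  exists (z : A) (mu : {linear A -> A}) (nu : A -> A)
         (b : {bilinear A -> A -> A}),
    [/\ is_central z,
        forall x, is_central (mu x),
        forall x y, is_central (b x y),
        forall x, nu x = bitrace b x
      & forall x, T x = z * x ^+ 2 + mu x * x + nu x].

(* Main.v *)
Require Import Defs.
From HB Require Import structures.
From mathcomp Require Import all_boot all_algebra.
From mathcomp Require Import ring.

(* Write B(x,y) = q(x,y) + q(y,x). Since 2 is not a zero divisor, commutation of
   the trace linearizes to [B(x,y),w] + [B(y,w),x] + [B(w,x),y] = 0. It suffices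
   to find a scalar z and a linear form mu such that
   B(x,y) - z(xy + yx) - mu(x)y - mu(y)x is scalar for all x, y in a basis.

   For size at least 3, any two matrix units e_ij, e_kl vanish on a common row
   r outside {i,k}; the (r,q) entry of the identity with w = e_rp then expresses
   the entries of B(e_ij,e_kl), up to a scalar matrix, by the numbers
   F(kl;p,i) = B(e_kl,e_rp)_ri, which do not depend on r. They also equal
   B(e_kl,e_ij)_pj for j outside {l,p}, and comparing the two descriptions forces
   F(kl;p,i) = z [p=k][i=l] + mu(e_kl) [p=i].

   For size 2 take z = 0 and normalize q by a linear form mu so that the traces
   of e_01, e_10, e_00 and the entry B(1,e_01)_01 lose their components along
   these units; commutation then makes B scalar on the basis
   1, e_00, e_01, e_10, because a matrix commuting with two of
   e_00, e_01, e_10 is scalar. *)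

Set Implicit Arguments.
Unset Strict Implicit.
Unset Printing Implicit Defensive.

Import GRing.Theory.
Local Open Scope ring_scope.

(** * Entries of products with matrix units, and scalar matrices *)

Section ScalarMatrices.
Variables (R : comNzRingType) (n : nat).
Implicit Types (A x : 'M[R]_n.+1) (i j p q : 'I_n.+1).

Lemma mulmx_deltaE A i j p q : (A * delta_mx i j) p q = A p i *+ (q == j).
Proof.
rewrite mxE (bigD1 i) //= big1 => [|k ki]; first by rewrite !mxE eqxx addr0 mulr_natr.
by rewrite !mxE (negPf ki) mulr0.
Qed.

Lemma delta_mulmxE A i j p q : (delta_mx i j * A) p q = A j q *+ (p == i).
Proof.
rewrite mxE (bigD1 j) //= big1 => [|k kj].
  by rewrite !mxE eqxx addr0 andbT mulr_natl.
by rewrite !mxE (negPf kj) andbF mul0r.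
Qed.

Lemma commutator_deltaE A i j p q :
  commutator A (delta_mx i j) p q = A p i *+ (q == j) - A j q *+ (p == i).
Proof.
by rewrite /commutator mxE [X in _ + X]mxE mulmx_deltaE delta_mulmxE.
Qed.

Lemma trace_mul_delta A i j : \tr (A *m delta_mx i j) = A j i.
Proof.
rewrite /mxtrace (bigD1 j) //= mulmx_deltaE eqxx big1 ?addr0 // => k kj.
by rewrite mulmx_deltaE (negPf kj).
Qed.

Lemma is_scalar_mxE A : is_scalar_mx A = (A == (A 0 0)%:M).
Proof.
apply/is_scalar_mxP/eqP => [[a ->]|->]; last by exists (A 0 0).
by rewrite mxE.
Qed.

Lemma is_scalar_mxD A x : is_scalar_mx A -> is_scalar_mx x -> is_scalar_mx (A + x).
Proof.
move=> /is_scalar_mxP[a ->] /is_scalar_mxP[b ->].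
by rewrite -raddfD scalar_mx_is_scalar.
Qed.

Lemma is_scalar_mxZ a A : is_scalar_mx A -> is_scalar_mx (a *: A).
Proof.
by move=> /is_scalar_mxP[b ->]; rewrite scale_scalar_mx scalar_mx_is_scalar.
Qed.

Lemma is_scalar_mx_linear (f : {linear 'M[R]_n.+1 -> 'M[R]_n.+1}) :
  (forall i j, is_scalar_mx (f (delta_mx i j))) -> forall x, is_scalar_mx (f x).
Proof.
move=> sf x; rewrite (matrix_sum_delta x) linear_sum.
apply: (big_ind (@is_scalar_mx _ _)) => [||i _];
  [exact: mx0_is_scalar|exact: is_scalar_mxD|].
rewrite linear_sum; apply: (big_ind (@is_scalar_mx _ _)) => [||j _];
  [exact: mx0_is_scalar|exact: is_scalar_mxD|].
by rewrite linearZ; apply: is_scalar_mxZ.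
Qed.

Lemma is_scalar_mx_bilinear
    (f : {bilinear 'M[R]_n.+1 -> 'M[R]_n.+1 -> 'M[R]_n.+1}) :
  (forall i j k l, is_scalar_mx (f (delta_mx i j) (delta_mx k l))) ->
  forall x y, is_scalar_mx (f x y).
Proof.
move=> sf x y; rewrite -applyrE; move: x.
apply: is_scalar_mx_linear => i j /=.
by apply: (is_scalar_mx_linear (f := f (delta_mx i j))) => k l; apply: sf.
Qed.

Lemma central_scalar_mx (a : R) : is_central (a%:M : 'M[R]_n.+1).
Proof. exact: comm_scalar_mx. Qed.

Lemma two_torsionfree_mx : two_torsionfree R -> two_torsionfree 'M[R]_n.+1.
Proof.
move=> tfR A /matrixP A0; apply/matrixP=> i j; rewrite mxE.
by apply: tfR; move: (A0 i j); rewrite mulmxnE mxE.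
Qed.

End ScalarMatrices.

(** * Polarization of the trace and linearized commutation *)

Section Polarization.
Variables (R : comNzRingType) (n : nat).
Local Notation M := 'M[R]_n.+1.

Definition polar (q : M -> M -> M) (x y : M) : M := q x y + q y x.

Lemma polarC q x y : polar q x y = polar q y x.
Proof. exact: addrC. Qed.

Lemma polar_bilinear (q : {bilinear M -> M -> M}) :
  bilinear_for *:%R *:%R (polar q).
Proof.
by split=> z a x y; rewrite /polar !linearDl !linearZl_LR !linearDr !linearZr_LR;
  rewrite addrACA -scalerDr.
Qed.

HB.instance Definition _ (q : {bilinear M -> M -> M}) :=
  bilinear_isBilinear.Build R M M M *:%R *:%R (polar q) (polar_bilinear q).

(** On the diagonal this is the trace minus its expected non-central part. The linear form mu is
    encoded as x |-> tr(cx), and the formula is kept bilinear so that the polarization lemmas apply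
    to it again. *)
Definition reduced (q : M -> M -> M) (z : R) (c : M) (x y : M) : M :=
  q x y - z *: (x * y) - \tr (c *m x) *: y.

Lemma reduced_bilinear (q : {bilinear M -> M -> M}) z c :
  bilinear_for *:%R *:%R (reduced q z c).
Proof.
split=> u a x y; apply/matrixP=> i j; rewrite /reduced.
  rewrite linearDl linearZl_LR mulrDl -scalerAl mulmxDr mxtraceD -scalemxAr mxtraceZ.
  by rewrite !mxE /=; ring.
rewrite (linearDr q) (linearZr_LR q) mulrDr -scalerAr.
by rewrite !mxE /=; ring.
Qed.

HB.instance Definition _ (q : {bilinear M -> M -> M}) z c :=
  bilinear_isBilinear.Build R M M M *:%R *:%R (reduced q z c)
    (reduced_bilinear q z c).

Definition trace_form (c x : M) : M := (\tr (c *m x))%:M.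

Lemma trace_form_linear c : linear (trace_form c).
Proof.
move=> a x y; rewrite /trace_form mulmxDr mxtraceD -scalemxAr mxtraceZ.
by rewrite raddfD /= scale_scalar_mx.
Qed.

HB.instance Definition _ c :=
  GRing.isLinear.Build R M M *:%R (trace_form c) (trace_form_linear c).

Definition corner (q : M -> M -> M) (x y : M) : M := (q x y 0 0)%:M.

Lemma corner_bilinear (q : {bilinear M -> M -> M}) :
  bilinear_for *:%R *:%R (corner q).
Proof.
by split=> u a x y; rewrite /corner ?linearDl ?linearZl_LR ?linearDr ?linearZr_LR;
  rewrite !mxE raddfD /= scale_scalar_mx.
Qed.

HB.instance Definition _ (q : {bilinear M -> M -> M}) :=
  bilinear_isBilinear.Build R M M M *:%R *:%R (corner q) (corner_bilinear q).

(* The first entry of a scalar matrix determines it, so [corner] turns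
   [reduced q z c] into a center-valued bilinear map with the same trace. *)
Lemma proper_of_scalar_reduced (q : {bilinear M -> M -> M}) z c :
  (forall x, is_scalar_mx (reduced q z c x x)) -> proper_trace (bitrace q).
Proof.
move=> sr; exists z%:M, (trace_form c), (bitrace (corner (reduced q z c))).
exists (corner (reduced q z c)).
split=> [||x y|//|x]; [exact: central_scalar_mx|by move=> x; exact: central_scalar_mx|
  exact: central_scalar_mx|].
have := sr x; rewrite is_scalar_mxE => /eqP.
rewrite /bitrace /trace_form /corner => <-.
by rewrite /reduced expr2 -mulmxE !mul_scalar_mx [RHS]addrC [X in _ = _ + X]addrC addrA !subrK.
Qed.

(** On the diagonal the polarization is twice the trace, and the factor 2 cancels entrywise. *)
Lemma scalar_of_polar (q : {bilinear M -> M -> M}) :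
  two_torsionfree R ->
  (forall x y, is_scalar_mx (polar q x y)) -> forall x, is_scalar_mx (q x x).
Proof.
move=> tfR sB x; rewrite is_scalar_mxE -subr_eq0; apply/eqP.
apply: (two_torsionfree_mx tfR).
have := sB x x; rewrite is_scalar_mxE /polar -mulr2n => /eqP E.
by rewrite mulrnBl E mulmxnE raddfMn subrr.
Qed.

Section Commuting.
Variable q : {bilinear M -> M -> M}.
Hypothesis tfR : two_torsionfree R.
Hypothesis qC : commuting_map (bitrace q).

Lemma commutatorDl (x y w : M) :
  commutator (x + y) w = commutator x w + commutator y w.
Proof. by rewrite /commutator mulrDl mulrDr opprD addrACA. Qed.

Lemma commutatorDr (x y w : M) :
  commutator w (x + y) = commutator w x + commutator w y.
Proof. by rewrite /commutator mulrDl mulrDr opprD addrACA. Qed.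

Lemma commutatorNr (x w : M) : commutator w (- x) = - commutator w x.
Proof. by rewrite /commutator mulrN mulNr opprB opprK addrC. Qed.

Lemma commutatorNl (x w : M) : commutator (- x) w = - commutator x w.
Proof. by rewrite /commutator mulrN mulNr opprB opprK addrC. Qed.

Lemma bitraceD x y : bitrace q (x + y) = bitrace q x + polar q x y + bitrace q y.
Proof. by rewrite /bitrace /polar !linearDl !linearDr !addrA. Qed.

Lemma bitraceN x : bitrace q (- x) = bitrace q x.
Proof. by rewrite /bitrace linearNl linearNr opprK. Qed.

Lemma polarNr x y : polar q x (- y) = - polar q x y.
Proof. exact: (linearNr (polar q)). Qed.

Lemma polarDl x y w : polar q (x + y) w = polar q x w + polar q y w.
Proof. exact: (linearDl (polar q)). Qed.

(** Commutation at x + y and at x - y differ by twice the part odd in y, which is the left-hand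
    side. *)
Lemma commuting_polar x y :
  commutator (bitrace q x) y + commutator (polar q x y) x = 0.
Proof.
apply: (two_torsionfree_mx tfR).
have := qC (x + y); have := qC (x - y).
rewrite !bitraceD bitraceN polarNr.
move: (polar q x y) (qC x) (qC y) => b.
rewrite !(commutatorDr, commutatorNr, commutatorDl, commutatorNl) => -> ->.
rewrite !(add0r, addr0, oppr0, opprK).
move: (commutator b x) (commutator b y) => bx by'.
move: (commutator (bitrace q x) y) (commutator (bitrace q y) x) => tx ty e1 e2.
have -> : (tx + bx) *+ 2 = (bx + ty + (tx + by')) - (- bx + ty - (tx - by')).
  by apply/matrixP=> i j; rewrite !mxE; ring.
by rewrite e1 e2 subr0.
Qed.

(** Polarizes [commuting_polar] in x: its instance at x + w minus those at x and at w. *)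
Lemma commuting_polar_cyclic x y w :
  commutator (polar q x y) w + commutator (polar q y w) x
    + commutator (polar q w x) y = 0.
Proof.
have := commuting_polar (x + w) y.
have := commuting_polar x y; have := commuting_polar w y.
rewrite bitraceD polarDl (polarC q y w) (polarC q w x).
move: (polar q _ _) (polar q _ _) (polar q _ _) => a b c.
rewrite !(commutatorDr, commutatorDl).
move: (commutator (bitrace q _) _) (commutator (bitrace q _) _) => tx tw.
move: (commutator _ _) => d1; move: (commutator _ _) => d2.
move: (commutator _ _) => d3; move: (commutator _ _) => d4.
move: (commutator _ _) => d5 h1 h2 h3.
have -> : d5 + d4 + d3
    = (tx + d3 + tw + (d2 + d4 + (d5 + d1))) - (tx + d2) - (tw + d1).
  by apply/matrixP=> i j; rewrite !mxE; ring.
by rewrite h1 h2 h3 !subr0.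
Qed.

End Commuting.

End Polarization.

(** * Matrices of size at least 3 *)

Section LargeSize.
Variables (R : comNzRingType) (n : nat).
Local Notation M := 'M[R]_n.+3.
Variable B : M -> M -> M.
Hypothesis BC : forall x y, B x y = B y x.
Hypothesis Bcyclic : forall x y w,
  commutator (B x y) w + commutator (B y w) x + commutator (B w x) y = 0.
Implicit Types i j k l p r s t : 'I_n.+3.

Let b i j k l : M := B (delta_mx i j) (delta_mx k l).

Let bC i j k l : b i j k l = b k l i j.
Proof. exact: BC. Qed.

(** The cyclic identity on three matrix units, read at one entry. The lemmas below choose indices
    for which most Kronecker deltas vanish. *)
Let b_cyclic i j k l r s p t :
  b i j k l p r *+ (t == s) - b i j k l s t *+ (p == r)
    + (b k l r s p i *+ (t == j) - b k l r s j t *+ (p == i))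
    + (b r s i j p k *+ (t == l) - b r s i j l t *+ (p == k)) = 0.
Proof.
have /matrixP/(_ p t) := Bcyclic (delta_mx i j) (delta_mx k l) (delta_mx r s).
by rewrite mxE [X in X + _]mxE !commutator_deltaE mxE.
Qed.

(** The default [ord0] is never reached, since two indices cannot exhaust at least three. *)
Definition third i k : 'I_n.+3 := odflt ord0 [pick r | (r != i) && (r != k)].

Lemma thirdP i k : third i k != i /\ third i k != k.
Proof.
rewrite /third; case: pickP => [r /andP[] //|none].
have: (#|'I_n.+3| <= #|[set i; k]|)%N.
  apply: subset_leq_card; apply/subsetP=> r _; rewrite !inE.
  by have /negbT := none r; rewrite negb_and !negbK.
by rewrite card_ord cards2; case: (i != k).
Qed.

Ltac simp_neq := repeat match goal with
  | H : is_true (?a != ?b) |- context [?a == ?b] => rewrite (negPf H)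
  | H : is_true (?a != ?b) |- context [?b == ?a] => rewrite (eq_sym b a) (negPf H)
  end.

Let simp0 := (mulr0n, mulr1n, subr0, sub0r, add0r, addr0, eqxx).

(* The number F(kl;p,i) of the header, for the choice r = third k i. *)
Definition coef k l p i : R := b k l (third k i) p (third k i) i.

(** Entry (r,j) of the identity for e_kl, e_ij, e_rp. The left side is free of r and the right side
    of j, so their common value depends on neither. *)
Lemma coef_transfer k l p i r j : r != k -> r != i -> j != l -> j != p ->
  b k l i j p j = b k l r p r i.
Proof.
move=> rk ri jl jp; have := b_cyclic k l i j r p r j.
by simp_neq; rewrite !simp0 (bC r p) => /eqP; rewrite addrC subr_eq0 => /eqP.
Qed.

Lemma coefEl k l p i r : r != k -> r != i -> b k l r p r i = coef k l p i.
Proof.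
move=> rk ri; have [jl jp] := thirdP l p; have [sk si] := thirdP k i.
by rewrite -(coef_transfer rk ri jl jp) (coef_transfer sk si jl jp).
Qed.

Lemma coefEr k l p i j : j != l -> j != p -> b k l i j p j = coef k l p i.
Proof.
by move=> jl jp; have [sk si] := thirdP k i; rewrite (coef_transfer sk si jl jp).
Qed.

Lemma coef_row0 k l p i : p != i -> p != k -> coef k l p i = 0.
Proof.
move=> pi pk; have [jl jp] := thirdP l p; rewrite -(coefEr _ _ jl jp).
move: (third l p) jl jp => j jl jp.
have [sj sl] := thirdP j l; move: (third j l) sj sl => s sj sl.
(* At entry (p,s), with s outside {j,l}, only the wanted term survives. *)
by have := b_cyclic k l i j j s p s; simp_neq; rewrite !simp0.
Qed.

Lemma coef_col0 k l p i : i != p -> i != l -> coef k l p i = 0.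
Proof.
move=> ip il; have [rk ri] := thirdP k i; rewrite -(coefEl _ _ rk ri).
move: (third k i) rk ri => r rk ri.
have [sk sr] := thirdP k r; move: (third k r) sk sr => s sk sr.
have := b_cyclic k l r p s r s i; simp_neq; rewrite !simp0.
by move=> /eqP; rewrite oppr_eq0 => /eqP.
Qed.

(** The single entry B(e_kl,e_pq)_pq is read once by its column and once by its row. *)
Lemma coef_diag_swap k l p q : p != q -> p != k -> q != l ->
  coef k l p p = coef k l q q.
Proof.
move=> pq pk ql; have qp : q != p by rewrite eq_sym.
by rewrite -(coefEr _ _ ql qp) -(coefEl _ _ pk pq).
Qed.

Definition mu k l : R := coef k l (third k k) (third k k).

(** Swaps lead to the reference index of [mu]. The excluded case p = k = l is the one where [zeta]
    also contributes. *)
Lemma coef_diag k l p : (p != k) || (k != l) -> coef k l p p = mu k l.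
Proof.
rewrite /mu; have [uk _] := thirdP k k; move: (third k k) uk => u uk.
have [-> //|pu] := eqVneq p u.
have [pl|pl _] := eqVneq p l; last by rewrite -(@coef_diag_swap k l u p) // eq_sym.
rewrite -{}pl (eq_sym k) orbb => pk.
by apply: coef_diag_swap; rewrite // eq_sym.
Qed.

Definition zeta k l : R := coef k l k l - mu k l *+ (k == l).

Lemma coefE k l p i :
  coef k l p i = zeta k l *+ ((p == k) && (i == l)) + mu k l *+ (p == i).
Proof.
rewrite /zeta; have [->|pk] := eqVneq p k; have [->|il] := eqVneq i l => /=.
- by rewrite subrK.
- have [ki|ki] := eqVneq k i; last by rewrite coef_col0 ?simp0 // eq_sym.
  by rewrite -ki coef_diag ?simp0 // ki il orbT.
- have [<-|pl] := eqVneq p l; last by rewrite coef_row0 ?simp0.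
  by rewrite coef_diag ?simp0 // pk.
have [<-|pi] := eqVneq p i; last by rewrite coef_row0 ?simp0.
by rewrite coef_diag ?simp0 // pk.
Qed.

Lemma b_expansion i j k l r p q : r != i -> r != k ->
  b i j k l p q
  = b i j k l r r *+ (q == p) + coef k l p i *+ (q == j) + coef i j p k *+ (q == l).
Proof.
move=> ri rk; have := b_cyclic i j k l r p r q; simp_neq; rewrite !simp0.
rewrite (bC r p) !coefEl // -!addrA addrCA => /eqP.
by rewrite addrC subr_eq0 addrA => /eqP <-.
Qed.

(** For k != l, evaluate B(e_ll,e_kl)_kl both by [coefEl] and by [b_expansion]. *)
Lemma zeta_col k l : zeta k l = zeta l l.
Proof.
have [->//|kl] := eqVneq k l.
have [rl rk] := thirdP l k.
have := @coefEl l l l l k kl kl; rewrite (b_expansion _ _ _ _ rl rk).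
rewrite (eq_sym l k) /zeta; simp_neq; rewrite !simp0 => <-.
by rewrite (@coef_diag _ _ k) ?kl // addrK.
Qed.

Lemma zeta_const k l : zeta k l = zeta 0 0.
Proof.
suff zz l' j : zeta l' l' = zeta j j by rewrite zeta_col; apply: zz.
have [->//|lj] := eqVneq l' j.
have [kl kj] := thirdP l' j; move: (third l' j) kl kj => r rl rj.
(* Both sides become the (r,j) entry of B(e_rl',e_l'j), by the symmetry of B. *)
rewrite -(zeta_col r l') -(zeta_col l' j) /zeta; simp_neq; rewrite !simp0.
have [jl jr lr] : [/\ j != l', j != r & r != j] by rewrite !(eq_sym j).
by rewrite -(coefEr _ _ jl jr) bC coefEl.
Qed.

(** Inserting [coefE] in [b_expansion], the [zeta] terms are the entries of the two products and the
    [mu] terms those of the two units. What is left is the diagonal entry at a row outside {i,k},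
    times the identity. *)
Lemma polar_units_scalar i j k l :
  is_scalar_mx (B (delta_mx i j) (delta_mx k l)
    - zeta 0 0 *: (delta_mx i j * delta_mx k l + delta_mx k l * delta_mx i j)
    - mu i j *: delta_mx k l - mu k l *: delta_mx i j).
Proof.
have [ri rk] := thirdP i k; apply/is_scalar_mxP.
exists (b i j k l (third i k) (third i k)); apply/matrixP=> p q.
have := mulmx_deltaE (delta_mx i j) k l p q : _ = _ :> R.
have := mulmx_deltaE (delta_mx k l) i j p q : _ = _ :> R.
move: (_ * _) (_ * _) => d2 d1; rewrite !mxE -/(b i j k l) => -> ->.
rewrite (@b_expansion i j k l _ p q ri rk) !coefE !zeta_const.
rewrite (eq_sym p q).
by do 7 case: (_ == _); rewrite /= ?mulr1n ?mulr0n; ring.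
Qed.

End LargeSize.

Lemma scalar_trace_large (R : comNzRingType) (n : nat)
    (q : {bilinear 'M[R]_n.+3 -> 'M[R]_n.+3 -> 'M[R]_n.+3}) :
  two_torsionfree R -> commuting_map (bitrace q) ->
  exists z c, forall x, is_scalar_mx (reduced q z c x x).
Proof.
move=> tfR qC; set B := polar q.
have BC : forall x y, B x y = B y x by exact: polarC.
have Bcyclic := commuting_polar_cyclic tfR qC.
(* The indices are transposed because tr(c e_ij) = c_ji. *)
pose c : 'M[R]_n.+3 := \matrix_(j, i) mu B i j.
exists (zeta B 0 0), c; apply: scalar_of_polar => //; apply: is_scalar_mx_bilinear => i j k l.
have := polar_units_scalar BC Bcyclic i j k l.
rewrite /= /B /polar /reduced !trace_mul_delta ![c _ _]mxE.
congr is_scalar_mx; apply/matrixP=> p t; rewrite !mxE; ring.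
Qed.

(** The subtracted terms, multiples of x^2 and of x, commute with x. *)
Lemma commuting_reduced (R : comNzRingType) (n : nat)
    (q : {bilinear 'M[R]_n.+1 -> 'M[R]_n.+1 -> 'M[R]_n.+1}) z c :
  commuting_map (bitrace q) -> commuting_map (bitrace (reduced q z c)).
Proof.
move=> qC x; have := qC x; rewrite /commutator /bitrace /reduced => /eqP.
rewrite subr_eq0 => /eqP e; apply/eqP; rewrite subr_eq0; apply/eqP.
by rewrite !mulrBl !mulrBr e -!scalerAl -!scalerAr mulrA.
Qed.

(** * Matrices of size 2 *)

Section SizeTwo.
Variable R : comNzRingType.
Local Notation M := 'M[R]_2.
Implicit Types (A : M) (i j : 'I_2).

Let e i j : M := delta_mx i j.

Lemma ord2P i : i = 0 \/ i = 1.
Proof. by case: i => [[|[|//]] ?]; [left|right]; apply: val_inj. Qed.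

Lemma is_scalar_mx2 A : A 0 1 = 0 -> A 1 0 = 0 -> A 0 0 = A 1 1 -> is_scalar_mx A.
Proof.
move=> a01 a10 a00; rewrite is_scalar_mxE; apply/eqP/matrixP=> i j.
by case: (ord2P i) => ->; case: (ord2P j) => ->; rewrite !mxE //= ?mulr1n ?mulr0n.
Qed.

Lemma commutator_scalar A y : is_scalar_mx A -> commutator A y = 0.
Proof.
by move=> /is_scalar_mxP[a ->]; rewrite /commutator (central_scalar_mx a y) subrr.
Qed.

Lemma commutator1 A : commutator A 1 = 0.
Proof. by rewrite /commutator mulr1 mul1r subrr. Qed.

Lemma commutes_e01 A : commutator A (e 0 1) = 0 -> A 1 0 = 0 /\ A 0 0 = A 1 1.
Proof.
move=> /matrixP h; have := h 0 1; have := h 1 1; rewrite !commutator_deltaE !mxE /=.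
by rewrite !mulr1n !mulr0n subr0 => -> /eqP; rewrite subr_eq0 => /eqP.
Qed.

Lemma commutes_e10 A : commutator A (e 1 0) = 0 -> A 0 1 = 0 /\ A 0 0 = A 1 1.
Proof.
move=> /matrixP h; have := h 1 0; have := h 0 0; rewrite !commutator_deltaE !mxE /=.
by rewrite !mulr1n !mulr0n subr0 => -> /eqP; rewrite subr_eq0 => /eqP.
Qed.

Lemma commutes_e00 A : commutator A (e 0 0) = 0 -> A 0 1 = 0 /\ A 1 0 = 0.
Proof.
move=> /matrixP h; have := h 0 1; have := h 1 0; rewrite !commutator_deltaE !mxE /=.
by rewrite !mulr1n !mulr0n subr0 sub0r => -> /eqP; rewrite oppr_eq0 => /eqP.
Qed.

(** The identity replaces e_11 because commutators with it vanish. *)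
Let basis2 : seq M := [:: 1; e 0 0; e 0 1; e 1 0].

Lemma is_scalar_mx2_linear (f : {linear M -> M}) :
  {in basis2, forall u, is_scalar_mx (f u)} -> forall x, is_scalar_mx (f x).
Proof.
move=> sf; apply: is_scalar_mx_linear => i j.
case: (ord2P i) => ->; case: (ord2P j) => ->; try by apply: sf; rewrite !inE eqxx ?orbT.
have -> : delta_mx 1 1 = 1 + (-1) *: e 0 0 :> M.
  apply/matrixP=> p t; case: (ord2P p) => ->; case: (ord2P t) => ->;
  by rewrite !mxE /=; ring.
rewrite linearD linearZ; apply: is_scalar_mxD; last apply: is_scalar_mxZ;
  by apply: sf; rewrite !inE eqxx ?orbT.
Qed.

Lemma is_scalar_mx2_bilinear (f : {bilinear M -> M -> M}) :
  {in basis2 &, forall u v, is_scalar_mx (f u v)} -> forall x y, is_scalar_mx (f x y).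
Proof.
move=> sf x y; rewrite -applyrE; move: x; apply: is_scalar_mx2_linear => u uB /=.
by apply: (is_scalar_mx2_linear (f := f u)) => v vB; apply: sf.
Qed.

Section Normalized.
Variable r : {bilinear M -> M -> M}.
Hypothesis tfR : two_torsionfree R.
Hypothesis rC : commuting_map (bitrace r).
Hypothesis r01 : r (e 0 1) (e 0 1) 0 1 = 0.
Hypothesis r10 : r (e 1 0) (e 1 0) 1 0 = 0.
Hypothesis r00 : r (e 0 0) (e 0 0) 0 0 = r (e 0 0) (e 0 0) 1 1.
Hypothesis r1 : polar r 1 (e 0 1) 0 1 = 0.

Lemma scalar_trace_normalized x : is_scalar_mx (r x x).
Proof.
(* In each of the next three steps, commuting with the unit leaves one obstruction to being scalar,
   which the normalization removes. *)
have T01 : is_scalar_mx (r (e 0 1) (e 0 1)).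
  by have [? ?] := commutes_e01 (rC (e 0 1)); apply: is_scalar_mx2.
have T10 : is_scalar_mx (r (e 1 0) (e 1 0)).
  by have [? ?] := commutes_e10 (rC (e 1 0)); apply: is_scalar_mx2.
have T00 : is_scalar_mx (r (e 0 0) (e 0 0)).
  by have [? ?] := commutes_e00 (rC (e 0 0)); apply: is_scalar_mx2.
have T1 : is_scalar_mx (r 1 1).
  have c1 y : commutator (r 1 1) y = 0.
    by have := commuting_polar tfR rC 1 y; rewrite commutator1 addr0.
  by have [? ?] := commutes_e01 (c1 _); have [? _] := commutes_e10 (c1 _);
    apply: is_scalar_mx2.
(* Scalar traces at u and v make B(u,v) commute with both; two distinct units then force it to be
   scalar. *)
have polar_commutes u v : is_scalar_mx (r u u) -> commutator (polar r u v) u = 0.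
  move=> su; have := commuting_polar tfR rC u v.
  by rewrite /bitrace (commutator_scalar v su) add0r.
have polar_commutes' u v : is_scalar_mx (r v v) -> commutator (polar r u v) v = 0.
  by rewrite polarC; apply: polar_commutes.
have P01_10 : is_scalar_mx (polar r (e 0 1) (e 1 0)).
  have [? ?] := commutes_e01 (polar_commutes _ (e 1 0) T01).
  by have [? _] := commutes_e10 (polar_commutes' (e 0 1) _ T10); apply: is_scalar_mx2.
have P01_00 : is_scalar_mx (polar r (e 0 1) (e 0 0)).
  have [? ?] := commutes_e01 (polar_commutes _ (e 0 0) T01).
  by have [? _] := commutes_e00 (polar_commutes' (e 0 1) _ T00); apply: is_scalar_mx2.
have P10_00 : is_scalar_mx (polar r (e 1 0) (e 0 0)).
  have [? ?] := commutes_e10 (polar_commutes _ (e 0 0) T10).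
  by have [_ ?] := commutes_e00 (polar_commutes' (e 1 0) _ T00); apply: is_scalar_mx2.
have P1_01 : is_scalar_mx (polar r 1 (e 0 1)).
  by have [? ?] := commutes_e01 (polar_commutes' 1 _ T01); apply: is_scalar_mx2.
(* Commuting with 1 says nothing about B(1,v), so the second unit comes from the cyclic identity for
   1, e_01, v. *)
have c01 v : is_scalar_mx (polar r (e 0 1) v) -> commutator (polar r 1 v) (e 0 1) = 0.
  move=> sv; have := commuting_polar_cyclic tfR rC 1 (e 0 1) v.
  by rewrite (commutator_scalar _ P1_01) (commutator_scalar _ sv) !add0r polarC.
have P1_10 : is_scalar_mx (polar r 1 (e 1 0)).
  have [? ?] := commutes_e01 (c01 _ P01_10).
  by have [? _] := commutes_e10 (polar_commutes' 1 _ T10); apply: is_scalar_mx2.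
have P1_00 : is_scalar_mx (polar r 1 (e 0 0)).
  have [? ?] := commutes_e01 (c01 _ P01_00).
  by have [? _] := commutes_e00 (polar_commutes' 1 _ T00); apply: is_scalar_mx2.
apply: scalar_of_polar => //; apply: is_scalar_mx2_bilinear => u v.
rewrite !inE => /or4P[] /eqP -> /or4P[] /eqP ->;
  by [|rewrite /= polarC|apply: is_scalar_mxD].
Qed.

End Normalized.

Lemma scalar_trace_two (q : {bilinear M -> M -> M}) :
  two_torsionfree R -> commuting_map (bitrace q) ->
  exists z c, forall x, is_scalar_mx (reduced q z c x x).
Proof.
move=> tfR qC.
pose T i j := q (e i j) (e i j).
pose m := T 0 0 0 0 - T 0 0 1 1.
(* The coefficients prescribe mu on e_00, e_01, e_10; that of e_11 is chosen so that mu(1) = tr(c)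
   is B(1,e_01)_01. *)
pose c : M := m *: e 0 0 + (polar q 1 (e 0 1) 0 1 - m) *: e 1 1
  + T 0 1 0 1 *: e 1 0 + T 1 0 1 0 *: e 0 1.
(* z = 0 suffices: by Cayley-Hamilton x^2 = tr(x) x - det(x), so a multiple of x^2 is absorbed by mu
   and nu. *)
exists 0, c; apply: scalar_trace_normalized => //; first exact: commuting_reduced.
- by rewrite /= /reduced /e trace_mul_delta !mxE /=; ring.
- by rewrite /= /reduced /e trace_mul_delta !mxE /=; ring.
- by rewrite /= /reduced /e trace_mul_delta !mxE /= /m /T /e; ring.
rewrite /= /polar /reduced /e trace_mul_delta mulmx1 /mxtrace !big_ord_recl big_ord0 !mxE /=.
by ring.
Qed.

End SizeTwo.

Theorem corollary3p18 (R : idomainType) (n : nat)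
    (tfR : two_torsionfree R)
    (q : {bilinear 'M[R]_n.+1 -> 'M[R]_n.+1 -> 'M[R]_n.+1}) :
  commuting_map (bitrace q) -> proper_trace (bitrace q).
Proof.
move=> qC; suff [z [c sr]] : exists z c, forall x, is_scalar_mx (reduced q z c x x).
  exact: proper_of_scalar_reduced sr.
case: n => [|[|n]] in q qC *.
(* In size 1 every matrix is scalar. *)
- by exists 0, 0 => x; rewrite is_scalar_mxE; apply/eqP; rewrite -mx11_scalar.
- exact: scalar_trace_two.
exact: scalar_trace_large.
Qed.
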